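(* Let $0<\theta<1$ when $L\ge2$, or $\rho\le\theta<1$ when $L=1$. There exist $\gamma_\theta>0$ and $C_\theta<\infty$ such that, for every $z_0\in L_2(g_\theta)$, the solution $z_t=e^{\mathcal{K}t}z_0$ in $L_2(g_\theta)$ of $\dot z_t=\mathcal{K}z_t$ satisfies $$\|z_t\|_{L_2(g_\theta)}\le e^{-\gamma_\theta t}\,C_\theta\,\|z_0\|_{L_2(g_\theta)},\qquad t\ge0.$$
   Context: $\alpha,\beta>0$ with $\rho=\alpha/\beta<1$, $L\ge1$ an integer. $g_\theta=(\theta^k)_{k\ge1}$, and $L_2(g_\theta)$ is the Hilbert space of real sequences $x=(x(k))_{k\ge0}$ with $x(0)=0$ and $\|x\|_{L_2(g_\theta)}^2=\sum_{k\ge1}x(k)^2\theta^{-k}<\infty$. $\mathcal{K}x(k)=\beta L\rho^{L^{k-1}}x(k-1)-(\beta L\rho^{L^k}+\beta)x(k)+\beta x(k+1)$, $k\ge1$ (with $x(0)=0$); it is a bounded operator on $L_2(g_\theta)$. *)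

(* Defs.v *)
From HB Require Import structures.
From mathcomp Require Import all_boot all_order all_algebra.
From mathcomp Require Import ring lra.
From mathcomp Require Import all_classical all_reals all_analysis.

Set Implicit Arguments.
Unset Strict Implicit.
Unset Printing Implicit Defensive.

Import Order.TTheory GRing.Theory Num.Theory.
Import numFieldNormedType.Exports.

Local Open Scope classical_set_scope.
Local Open Scope ring_scope.

Lemma is_cvg_series_shiftS (R : realType) (f : nat -> R) :
  cvgn (series (fun k => f k.+1)) <-> cvgn (series f).
Proof.
have E : series (fun k => f k.+1) =
    (fun n => series f n.+1) - cst (f 0%N).
  apply/funext => n; suff: series (fun k => f k.+1) n =
    series f n.+1 - f 0%N by [].
  by rewrite /series /= big_nat_recl//= addrAC subrr add0r.
have S : cvgn (fun n => series f n.+1) = cvgn (series f).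
  by rewrite propeqE; split=> /cvg_ex[l c]; apply/cvg_ex; exists l;
    move: c; rewrite (cvg_shiftS (series f)).
rewrite E -S; split=> c; last by apply: is_cvgB => //; exact: is_cvg_cst.
rewrite -[X in cvgn X](subrK (cst (f 0%N))).
by apply: is_cvgD => //; exact: is_cvg_cst.
Qed.

Lemma is_cvg_seriesMl (R : realType) (a : R) (f : nat -> R) :
  cvgn (series f) -> cvgn (series (fun k => a * f k)).
Proof. exact: is_cvg_seriesZ. Qed.

(* L2g theta is the space L_2(g_theta), with g_theta = (theta^k)_(k >= 1), built
   as the subspace of the sequences nat -> R that vanish at 0 and have a finite
   weighted square sum; it is a complete normed module. *)
Section L2g.
Context {R : realType} (theta : {posnum R}).
Implicit Types x y : nat -> R.

(* The index is shifted: the term of rank k is x(k+1)^2 theta^-(k+1), so that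
   the series below run over the indices >= 1. *)
Definition l2g_term x : nat -> R :=
  fun k => x k.+1 ^+ 2 * theta%:num ^- k.+1.

Definition in_l2g : {pred (nat -> R)} :=
  fun x => `[< x 0%N = 0 /\ cvgn (series (l2g_term x)) >].

Lemma in_l2gP x :
  reflect (x 0%N = 0 /\ cvgn (series (l2g_term x))) (x \in in_l2g).
Proof. exact: asboolP. Qed.

Let w_ge0 k : 0 <= theta%:num ^- k.
Proof. by rewrite invr_ge0 exprn_ge0. Qed.

Lemma l2g_term_ge0 x k : 0 <= l2g_term x k.
Proof. by rewrite mulr_ge0// sqr_ge0. Qed.

Lemma l2g_termZ a x : l2g_term (a *: x) = a ^+ 2 *: l2g_term x.
Proof.
by apply/funext => k; rewrite /l2g_term /= -[(a *: x) _]/(a * x _) exprMn -mulrA.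
Qed.

Lemma l2g_cvgZ a x : cvgn (series (l2g_term x)) ->
  cvgn (series (l2g_term (a *: x))).
Proof. by move=> cx; rewrite l2g_termZ; exact: is_cvg_seriesZ. Qed.

Lemma l2g_cvg_le x y M : (forall k, `|y k.+1| <= M * `|x k.+1|) ->
  cvgn (series (l2g_term x)) -> cvgn (series (l2g_term y)).
Proof.
move=> yx /(@l2g_cvgZ M x); apply: series_le_cvg;
  try exact: l2g_term_ge0.
move=> k; rewrite /l2g_term ler_wpM2r//.
rewrite -(real_normK (num_real (y _))) -(real_normK (num_real ((M *: x) _))).
rewrite ler_sqr ?nnegrE// (le_trans (yx k))// -[(M *: x) _]/(M * x _) normrM.
by rewrite ler_wpM2r// ler_norm.
Qed.

Lemma l2g_cvgD x y : cvgn (series (l2g_term x)) ->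
  cvgn (series (l2g_term y)) -> cvgn (series (l2g_term (x + y))).
Proof.
move=> cx cy; have := @is_cvg_seriesZ R _ 2 (is_cvg_seriesD cx cy).
apply: series_le_cvg; first exact: l2g_term_ge0.
  by move=> k; rewrite mulr_ge0// addr_ge0 ?l2g_term_ge0.
move=> k; suff: l2g_term (x + y) k <= 2 * (l2g_term x k + l2g_term y k) by [].
rewrite /l2g_term -mulrDl mulrA ler_wpM2r// -[(x + y) _]/(x _ + y _).
by have := sqr_ge0 (x k.+1 - y k.+1); nra.
Qed.

Lemma in_l2g_submod_closed : submod_closed in_l2g.
Proof.
split=> [|a x y /in_l2gP[x0 cx] /in_l2gP[y0 cy]]; apply/in_l2gP; split=> //.
- rewrite (_ : series _ = cst 0); first exact: is_cvg_cst.
  apply/funext => n; rewrite /series /= big1// => k _.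
  by rewrite /l2g_term [X in X ^+ 2](_ : _ = 0)// expr0n mul0r.
- by rewrite -[LHS]/(a * x 0%N + y 0%N) x0 y0 mulr0 addr0.
- by apply: l2g_cvgD => //; exact: l2g_cvgZ.
Qed.

HB.instance Definition _ :=
  GRing.isSubmodClosed.Build R (nat -> R) in_l2g in_l2g_submod_closed.

Record L2g := MkL2g { l2g_seq :> nat -> R; _ : l2g_seq \in in_l2g }.

HB.instance Definition _ := [isSub for l2g_seq].
HB.instance Definition _ := [Choice of L2g by <:].
HB.instance Definition _ := [SubChoice_isSubLmodule of L2g by <:].

Implicit Types u v : L2g.

Lemma l2g_seq0 u : u 0%N = 0.
Proof. by have /in_l2gP[] := valP u. Qed.

Lemma l2g_seq_cvg u : cvgn (series (l2g_term u)).
Proof. by have /in_l2gP[] := valP u. Qed.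

Lemma l2g_seqD u v k : (u + v) k = u k + v k. Proof. by []. Qed.

Lemma l2g_seqZ a u k : (a *: u) k = a * u k. Proof. by []. Qed.

Lemma l2g_seqB u v k : (u - v) k = u k - v k. Proof. by []. Qed.

Definition l2g_norm u : R := Num.sqrt (limn (series (l2g_term u))).

Lemma l2g_lim_ge u n : series (l2g_term u) n <= limn (series (l2g_term u)).
Proof.
apply: nondecreasing_cvgn_le; last exact: l2g_seq_cvg.
by apply: nondecreasing_series => k _ _; exact: l2g_term_ge0.
Qed.

Lemma l2g_lim_ge0 u : 0 <= limn (series (l2g_term u)).
Proof. by have := l2g_lim_ge u 0; rewrite /series /= big_geq. Qed.

Lemma l2g_normK u : l2g_norm u ^+ 2 = limn (series (l2g_term u)).
Proof. by rewrite sqr_sqrtr// l2g_lim_ge0. Qed.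

Lemma l2g_coord_le u k : `|u k.+1| <= Num.sqrt (theta%:num ^+ k.+1) * l2g_norm u.
Proof.
rewrite /l2g_norm -sqrtrM ?exprn_ge0// -sqrtr_sqr ler_wsqrtr//.
rewrite -ler_pdivrMl ?exprn_gt0// mulrC.
apply: le_trans (l2g_lim_ge u k.+1).
by rewrite seriesS ler_wpDr// sumr_ge0// => i _; exact: l2g_term_ge0.
Qed.

Lemma l2g_norm_eq0 u : l2g_norm u = 0 -> u = 0.
Proof.
move=> u0; apply/val_inj/funext => -[|k]; first by rewrite [LHS]l2g_seq0.
have := l2g_coord_le u k; rewrite u0 mulr0 normr_le0 => /eqP uk0.
exact: uk0.
Qed.

Lemma l2g_normZ a u : l2g_norm (a *: u) = `|a| * l2g_norm u.
Proof.
rewrite /l2g_norm [l2g_term _](_ : _ = a ^+ 2 *: l2g_term u); last first.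
  by rewrite -l2g_termZ.
rewrite lim_seriesZ; last exact: l2g_seq_cvg.
by rewrite sqrtrM ?sqr_ge0// sqrtr_sqr.
Qed.

Lemma l2g_norm_le u M : 0 <= M ->
  (forall n, series (l2g_term u) n <= M ^+ 2) -> l2g_norm u <= M.
Proof.
move=> M0 uM; rewrite -(ger0_norm M0) -sqrtr_sqr ler_wsqrtr//.
by apply: limr_le; [exact: l2g_seq_cvg|exact: nearW].
Qed.

Lemma ler_l2g_normD u v : l2g_norm (u + v) <= l2g_norm u + l2g_norm v.
Proof.
have [->|u0] := eqVneq u 0; first by rewrite add0r lerDr sqrtr_ge0.
have [->|v0] := eqVneq v 0; first by rewrite addr0 lerDl sqrtr_ge0.
set a := l2g_norm u; set b := l2g_norm v.
have a0 : 0 < a.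
  by rewrite lt_def sqrtr_ge0 andbT; apply: contra_neq u0 => /l2g_norm_eq0.
have b0 : 0 < b.
  by rewrite lt_def sqrtr_ge0 andbT; apply: contra_neq v0 => /l2g_norm_eq0.
apply: l2g_norm_le => [|n]; first by rewrite addr_ge0// ltW.
have -> : (a + b) ^+ 2 = (1 + b / a) * a ^+ 2 + (1 + a / b) * b ^+ 2.
  by field; rewrite !gt_eqF.
apply: (@le_trans _ _ ((1 + b / a) * series (l2g_term u) n +
                       (1 + a / b) * series (l2g_term v) n)).
  rewrite /series /= !mulr_sumr -big_split /= ler_sum// => k _.
  suff: (u k.+1 + v k.+1) ^+ 2 * theta%:num ^- k.+1 <=
      (1 + b / a) * (u k.+1 ^+ 2 * theta%:num ^- k.+1) +
      (1 + a / b) * (v k.+1 ^+ 2 * theta%:num ^- k.+1) by [].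
  rewrite !mulrA -mulrDl ler_wpM2r//.
  rewrite -subr_ge0 [leRHS](_ : _ = (b * u k.+1 - a * v k.+1) ^+ 2 / (a * b)).
    by rewrite divr_ge0 ?sqr_ge0// mulr_ge0// ltW.
  by field; rewrite !gt_eqF.
by rewrite !l2g_normK lerD// ler_wpM2l ?l2g_lim_ge// addr_ge0// divr_ge0// ltW.
Qed.

HB.instance Definition _ :=
  @Lmodule_isNormed.Build R L2g l2g_norm ler_l2g_normD l2g_normZ l2g_norm_eq0.

Lemma l2g_normE u : `|u| = Num.sqrt (limn (series (l2g_term u))).
Proof. by []. Qed.

Lemma l2g_cauchy_cvg (F : set_system L2g) : ProperFilter F ->
  cauchy F -> cvg F.
Proof.
move=> FF Fc.
have Fball e : 0 < e -> exists u, \forall v \near F, `|u - v| < e.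
  move=> e0; have /cauchyP/(_ e e0)[u Fu] := Fc.
  by exists u; move: Fu; rewrite -ball_normE.
have cvgF k : cvg ((fun v : L2g => v k.+1 : R^o) @ F).
  apply: cauchy_cvg; apply/cauchyP => e e0.
  set c := Num.sqrt (theta%:num ^+ k.+1).
  have c0 : 0 < c by rewrite sqrtr_gt0 exprn_gt0.
  have [u Fu] := Fball (e / c) (divr_gt0 e0 c0).
  exists (u k.+1).
  suff: \forall v \near F, `|(u - v) k.+1| < e by rewrite -ball_normE.
  near=> v.
  apply: le_lt_trans (l2g_coord_le _ _) _.
  rewrite -/c mulrC -ltr_pdivlMr// -[l2g_norm _]/(`|u - v|).
  by near: v.
pose z k := if k is j.+1 then lim ((fun v : L2g => v j.+1 : R^o) @ F) else 0.
have zle e (u : L2g) : 0 < e -> (\forall v \near F, `|u - v| < e) ->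
    forall n, series (l2g_term ((u : nat -> R) - z)) n <= e ^+ 2.
  move=> e0 Fu n; rewrite /series /=.
  have : (fun v : L2g => \sum_(0 <= k < n) l2g_term (u - v) k : R^o) @ F -->
      \sum_(0 <= k < n) l2g_term ((u : nat -> R) - z) k.
    apply: cvg_big => [|k _]; first exact: add_continuous.
    rewrite /l2g_term.
    apply: cvgM; last exact: cvg_cst.
    rewrite (_ : (fun x : L2g => (u - x) k.+1 ^+ 2) =
      (fun x : L2g => (u k.+1 - x k.+1) * (u k.+1 - x k.+1))); last first.
      by apply/funext => v; rewrite l2g_seqB expr2.
    rewrite expr2 -[((u : nat -> R) - z) _]/(u k.+1 - z k.+1).
    by apply: cvgM; apply: cvgB; [exact: cvg_cst|exact: cvgF|
      exact: cvg_cst|exact: cvgF].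
  move=> cF; rewrite -(cvg_lim _ cF)//; apply: limr_le; first exact: cvgP cF.
  near=> v.
  apply: le_trans (l2g_lim_ge (u - v) n) _.
  rewrite -l2g_normK ler_sqr ?nnegrE ?sqrtr_ge0 ?(ltW e0)//.
  by rewrite -[l2g_norm _]/(`|u - v|) ltW//; near: v.
have cvg_uz e (u : L2g) : 0 < e -> (\forall v \near F, `|u - v| < e) ->
    cvgn (series (l2g_term ((u : nat -> R) - z))).
  move=> e0 Fu; apply: nondecreasing_is_cvgn.
    by apply: nondecreasing_series => k _ _; exact: l2g_term_ge0.
  by exists (e ^+ 2) => _ [n _ <-]; exact: (zle e u).
have zP : z \in in_l2g.
  apply/in_l2gP; split=> //; have [u Fu] := Fball 1 ltr01.
  rewrite -(subKr (u : nat -> R) z); apply: l2g_cvgD.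
    exact: l2g_seq_cvg.
  rewrite -scaleN1r; apply: l2g_cvgZ; exact: (cvg_uz 1 u).
apply/cvg_ex; exists (MkL2g zP); apply/cvgrPdist_lt => e e0.
have e20 : 0 < e / 2 by rewrite divr_gt0.
have [u Fu] := Fball (e / 2) e20.
near=> v; rewrite -(subrKA u) (le_lt_trans (ler_normD _ _))//.
rewrite [ltRHS]splitr ler_ltD//; last by near: v.
by rewrite distrC; apply: l2g_norm_le; [exact: ltW|exact: zle].
Unshelve. all: by end_near. Qed.

HB.instance Definition _ := Uniform_isComplete.Build L2g l2g_cauchy_cvg.

Variables (alpha beta : R) (L : nat).

Let rho := alpha / beta.

(* The operator is prescribed for k >= 1 only; the value 0 at k = 0 keeps the
   image in the space. *)
Definition Kseq x : nat -> R := fun k =>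
  if k is j.+1 then
    beta * L%:R * rho ^+ (L ^ j) * x j
    - (beta * L%:R * rho ^+ (L ^ j.+1) + beta) * x j.+1
    + beta * x j.+2
  else 0.

(* [insubd 0] is a total map into the subtype; Kop_val below shows that its
   default value is never used when [0 < alpha], [0 < beta] and [rho < 1]. *)
Definition Kop u : L2g := insubd 0 (Kseq u).

Lemma Kseq_in_l2g u : 0 < alpha -> 0 < beta -> rho < 1 -> Kseq u \in in_l2g.
Proof.
move=> a0 b0 r1.
have r0 : 0 <= rho by rewrite divr_ge0// ltW.
have rn n : 0 <= rho ^+ n <= 1 by rewrite exprn_ge0//= exprn_ile1// ltW.
have lc n : `|beta * L%:R * rho ^+ n| <= beta * L%:R.
  have /andP[h0 h1] := rn n.
  rewrite ger0_norm; first by rewrite ler_piMr// mulr_ge0// ltW.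
  by rewrite !mulr_ge0// ltW.
pose xl k := if k is j.+1 then u j else 0.
pose xr k := u k.+1.
have cl : cvgn (series (l2g_term xl)).
  apply/is_cvg_series_shiftS.
  rewrite (_ : (fun k => _) = fun k => theta%:num^-1 * l2g_term u k).
    by apply: is_cvg_seriesMl; exact: l2g_seq_cvg.
  by apply/funext => k; rewrite /l2g_term [in LHS]exprS invfM mulrCA.
have cr : cvgn (series (l2g_term xr)).
  rewrite (_ : l2g_term xr = fun k => theta%:num * l2g_term u k.+1).
    apply: is_cvg_seriesMl; apply/is_cvg_series_shiftS; exact: l2g_seq_cvg.
  by apply/funext => k; rewrite /l2g_term [in RHS]exprS invfM mulrCA mulVKf.
apply/in_l2gP; split=> //.
rewrite (_ : Kseq u = (fun k => beta * L%:R * rho ^+ (L ^ k.-1) * xl k)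
  + (-1) *: (fun k => (beta * L%:R * rho ^+ (L ^ k) + beta) *
                      (if k is 0 then 0 else u k))
  + beta *: (fun k => if k is 0 then 0 else xr k)); last first.
  apply/funext => -[|k].
    suff: 0 = beta * L%:R * rho ^+ (L ^ 0) * 0
      + -1 * ((beta * L%:R * rho ^+ (L ^ 0) + beta) * 0) + beta * 0 by [].
    by rewrite !mulr0 !addr0.
  suff: Kseq u k.+1 = beta * L%:R * rho ^+ (L ^ k) * u k
    + -1 * ((beta * L%:R * rho ^+ (L ^ k.+1) + beta) * u k.+1)
    + beta * u k.+2 by [].
  by rewrite mulN1r.
apply: l2g_cvgD; first apply: l2g_cvgD.
- apply: (@l2g_cvg_le xl _ (beta * L%:R)) cl => k.
  by rewrite normrM ler_wpM2r.
- apply: l2g_cvgZ; apply: (@l2g_cvg_le u _ (beta * L%:R + beta)).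
    move=> k; rewrite normrM ler_wpM2r// (le_trans (ler_normD _ _))//.
    by rewrite lerD// ger0_norm// ltW.
  exact: l2g_seq_cvg.
- apply: l2g_cvgZ; apply: (@l2g_cvg_le xr _ 1) cr => k.
  by rewrite mul1r.
Qed.

Lemma Kop_val u : 0 < alpha -> 0 < beta -> rho < 1 -> Kop u = Kseq u :> (nat -> R).
Proof. by move=> a0 b0 r1; apply: insubdK; exact: Kseq_in_l2g. Qed.

End L2g.

(* The partial sums of e^(tA) v. *)
Definition exp_series {R : realType} {V : normedModType R} (A : V -> V)
    (t : R) (v : V) : V^nat :=
  series (fun n => (t ^+ n / n`!%:R) *: iter n A v).

(* A solution on [0, +oo[ of the Cauchy problem z' = A z, z(0) = z0; the
   derivative is taken in the norm of V and is one-sided at t = 0. *)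
Definition is_ode_solution {R : realType} {V : normedModType R} (A : V -> V)
    (v0 : V) (z : R -> V) : Prop :=
  z 0 = v0 /\
  forall t, 0 <= t ->
    h^-1 *: (z (t + h) - z t) @[h --> within [set h | 0 <= t + h] 0^'] -->
    A (z t).

(* Main.v *)
Require Import Defs.
From HB Require Import structures.
From mathcomp Require Import all_boot all_order all_algebra.
From mathcomp Require Import ring lra.
From mathcomp Require Import all_classical all_reals all_analysis.

Set Implicit Arguments.
Unset Strict Implicit.
Unset Printing Implicit Defensive.

Import Order.TTheory GRing.Theory Num.Theory.
Import numFieldNormedType.Exports.

Local Open Scope classical_set_scope.
Local Open Scope ring_scope.

(** Divided by [beta], the operator is the forward equation of a birth-death
    chain absorbed at [0], with death rate [1] and birth rates
    [a k = L * rho ^+ (L ^ k)]. Put [s = sqrt theta]. The rates converge to a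
    limit [l < s]: to [0] when [L >= 2], and to [rho <= theta < s] when [L = 1].

    The norm of [L2g theta] need not decrease along the flow, because the rates
    of small index may be large, but an equivalent norm does. Suppose that
    positive sequences [p] and [u] satisfy [K^T p <= - g p] and [K u <= - h u]
    (contraction for a weighted l1 norm and for a weighted sup norm). Then
    interpolation suggests the weights [w = p / u], and indeed the elementary
    bound [2 * y k * y k.+1 <= y k ^+ 2 + y k.+1 ^+ 2] for [x = u * y] gives
    [<x, K x>_w <= - (g + h) / 2 * <x, x>_w] ([energy_flux_le] and
    [Kop_energy_le]). So it is enough to find such [p] and [u] with [p] of the
    order of [s ^- k] and [u] of the order of [s ^+ k], since [w] is then of the
    order of [theta ^- k].

    The geometric sequences themselves satisfy the two inequalities for large
    [k], because there [a k] is close to [l < s]. At small [k] they are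
    corrected by a large multiple of a bounded sequence [q], vanishing at [0],
    with [K^T q < 0] at every rank, respectively of [m * q] with [m] the
    reversible measure ([dual_supersolution_exists], [supersolution_exists]).

    The energy inequality makes every solution decay exponentially in the
    weighted norm ([l2w_decay]). Applied to a difference of two solutions this
    gives uniqueness; applied to the exponential series of the bounded operator
    [K], which is a solution ([exp_op_solution]), it gives the estimate. *)

(** * Contracting test sequences of a birth-death chain *)

(** Domination beyond some rank costs nothing, and the finitely many remaining
    inequalities hold once [B] is large: this is how a strict inequality that
    a test sequence satisfies everywhere, but with a vanishing margin, repairs
    the finitely many defects of a geometric sequence. *)
Lemma eventually_le0_dominated (R : realFieldType) (f d : nat -> R) :
    (forall n, 0 < d n) -> (\forall n \near \oo, f n <= 0) ->
  exists2 B, 0 <= B & forall n, f n <= B * d n.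
Proof.
move=> d0 [N _ fN]; pose B := \sum_(i < N) `|f i| / d i.
have t0 (i : 'I_N) : 0 <= `|f i| / d i by rewrite divr_ge0// ltW.
have B0 : 0 <= B by apply: sumr_ge0 => i _; exact: t0.
exists B => // n; have [nN|Nn] := ltnP n N; last first.
  by rewrite (le_trans (fN n Nn))// mulr_ge0// ltW.
rewrite -ler_pdivrMr//; apply: (@le_trans _ _ (`|f n| / d n)).
  by rewrite ler_wpM2r ?ler_norm// invr_ge0 ltW.
rewrite /B (bigD1 (Ordinal nN))//= lerDl.
by apply: sumr_ge0 => i _; exact: t0.
Qed.

Lemma prod_le_geometric (R : realFieldType) (a : nat -> R) (s : R) :
    (forall n, 0 < a n) -> 0 < s -> (\forall n \near \oo, a n <= s) ->
  exists2 C, 0 <= C & forall n, \prod_(i < n) a i <= C * s ^+ n.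
Proof.
move=> a0 s0 [N _ aN]; pose m n := \prod_(i < n) a i.
have m0 n : 0 < m n by apply: prodr_gt0.
(* Cutting the products off after rank N reduces the start of the induction to
   the previous lemma; from rank N on, each new factor is at most s. *)
pose f n := if (n <= N)%N then m n else 0.
have [||C C0 fC] := @eventually_le0_dominated R f (fun n => s ^+ n).
- by move=> n; rewrite exprn_gt0.
- by exists N.+1 => // n /= Nn; rewrite /f leqNgt Nn.
exists C => // n; elim: n => [|n IHn]; first by have := fC 0%N.
have [nN|Nn] := ltnP n N; first by have := fC n.+1; rewrite /f nN.
rewrite -/(m n.+1) /m big_ord_recr/= exprSr mulrA.
by rewrite ler_pM// ?(ltW (m0 n))// ?(ltW (a0 n))//; exact: aN.
Qed.

(** With increments [q k.+1 - q k] proportional to [e ^+ k], superharmonicity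
    reads [a j.+1 * e < 1], so any [e] below the inverse of a bound of the
    rates will do; the margin decays like [e ^+ j], hence is positive at every
    rank but not bounded below by a multiple of [q]. *)
Lemma strictly_superharmonic_exists (R : realType) (a : nat -> R) (l : R) :
    (forall n, 0 < a n) -> a @ \oo --> l ->
  exists q : nat -> R,
    [/\ forall k, 0 <= q k <= 1, forall k, q k <= q k.+1 &
        forall j, a j.+1 * (q j.+2 - q j.+1) - (q j.+1 - q j) < 0].
Proof.
move=> a0 al.
have [M Ma] : exists M, forall n, a n <= M.
  have /cvg_seq_bounded/bounded_fun_has_ubound[M Mub] : cvgn a.
    by apply/cvg_ex; exists l.
  by exists M => n; apply: Mub; exists n.
have M0 : 0 < M by rewrite (lt_le_trans (a0 0%N)).
pose e := (1 + M)^-1.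
have e0 : 0 < e by rewrite invr_gt0 addr_gt0.
have e1 : e < 1 by rewrite invf_lt1 ?addr_gt0// ltrDl.
have ae n : a n * e < 1.
  by rewrite ltr_pdivrMr ?addr_gt0// mul1r (le_lt_trans (Ma n))// ltrDr.
exists (fun k => 1 - e ^+ k); split=> [k|k|j].
- apply/andP; split; last by rewrite lerBlDr lerDl exprn_ge0// ltW.
  by rewrite subr_ge0 exprn_ile1// ltW.
- by rewrite lerD2l lerN2 exprS ler_piMl ?exprn_ge0// ltW.
- rewrite (_ : _ - _ = - (e ^+ j * (1 - e) * (1 - a j.+1 * e))).
    by rewrite oppr_lt0 !mulr_gt0 ?exprn_gt0// subr_gt0.
  by rewrite !exprS; ring.
Qed.

Section test_sequences.
Variables (R : realType) (a : nat -> R) (l s : R).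
Hypotheses (a0 : forall n, 0 < a n) (al : a @ \oo --> l).
Hypotheses (ls : l < s) (s0 : 0 < s) (s1 : s < 1).

(** The limiting value of [1 - s - a n * (s^-1 - 1)], the relative dissipation
    of the geometric sequences [s ^- n] and [s ^+ n] at infinity. *)
Let kappa := (1 - s) * (1 - l / s).

Let kappa_gt0 : 0 < kappa.
Proof. by rewrite mulr_gt0 ?subr_gt0// ltr_pdivrMr// mul1r. Qed.

(** A test sequence for the transposed operator. Alone, [s ^- k] contracts for
    large [k], where the rates are close to [l < s]; adding a large multiple of
    the superharmonic [q] corrects the small ranks, and since [q] is bounded it
    changes neither the growth [s ^- k] nor the contraction at infinity. *)
Lemma dual_supersolution_exists : exists g C : R, exists p : nat -> R,
  [/\ 0 < g, forall k, s ^- k <= p k <= C * s ^- k,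
      forall k, p k <= p k.+1 &
      forall j, a j.+1 * (p j.+2 - p j.+1) - (p j.+1 - p j) <= - g * p j.+1].
Proof.
have [q [q01 qS qd]] := @strictly_superharmonic_exists _ a l a0 al.
have k0 : 0 < kappa by [].
pose r := s^-1; have r1 : 1 < r by rewrite /r invf_gt1.
have r0 : 0 < r by rewrite (lt_trans ltr01).
have rs : r * s = 1 by rewrite mulVf// gt_eqF.
have cF : (fun n => a n.+1 * (r - 1) - (1 - s) + kappa / 2) @ \oo -->
    l * (r - 1) - (1 - s) + kappa / 2.
  apply: cvgD; last exact: cvg_cst.
  apply: cvgB; last exact: cvg_cst.
  by apply: cvgM; [rewrite (cvg_shiftS a)|exact: cvg_cst].
have L0 : l * (r - 1) - (1 - s) + kappa / 2 < 0.
  have -> : l * (r - 1) - (1 - s) + kappa / 2 = - (kappa / 2).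
    by rewrite /kappa /r; field; rewrite gt_eqF.
  by rewrite oppr_lt0 divr_gt0.
pose f j := r ^+ j.+1 * (a j.+1 * (r - 1) - (1 - s) + kappa / 2).
pose d j := - (a j.+1 * (q j.+2 - q j.+1) - (q j.+1 - q j)).
have [||B B0 fB] := @eventually_le0_dominated R f d.
- by move=> n; rewrite /d oppr_gt0.
- near=> n; rewrite /f pmulr_rle0 ?exprn_gt0//.
  by near: n; apply: (cvgr_le _ cF).
pose p k := r ^+ k + B * q k.
have p1 k : p k <= (1 + B) * r ^+ k.
  rewrite mulrDl mul1r lerD2l ler_wpM2l//.
  have /andP[_ qk] := q01 k; apply: (le_trans qk).
  by rewrite exprn_ege1// ltW.
exists (kappa / 2 / (1 + B)), (1 + B), p; split.
- by rewrite !divr_gt0// ltr_wpDr.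
- move=> k; rewrite -exprVn -/r p1 andbT lerDl mulr_ge0//.
  by have /andP[] := q01 k.
- move=> k; apply: lerD; last exact: ler_wpM2l.
  by rewrite exprS ler_peMl ?exprn_ge0// ltW.
- move=> j; apply: (@le_trans _ _ (- (kappa / 2 * r ^+ j.+1))).
    rewrite -subr_le0 (_ : _ - _ = f j - B * d j) ?subr_le0//.
    by rewrite /f /d /p; have := rs; rewrite !exprS => rs'; ring: rs'.
  rewrite mulNr lerN2 -[X in X <= _]mulrA.
  apply: ler_wpM2l; first by rewrite divr_ge0// ltW.
  by rewrite ler_pdivrMl ?ltr_wpDr.
Unshelve. all: by end_near. Qed.

(** A test sequence for the operator itself, by the same repair of [s ^+ k]. The
    correction is [m k * q k], where [m k] is the reversible measure of the
    chain, the product of the rates below [k]: multiplication by [m] carries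
    the transposed operator to the operator, so that [m * q] inherits the
    strict inequality of [q]. It is at most a multiple of [s ^+ k] because the
    rates are eventually below [s]. *)
Lemma supersolution_exists : exists g C : R, exists u : nat -> R,
  [/\ 0 < g, forall k, s ^+ k <= u k <= C * s ^+ k &
      forall j, a j * u j - (a j.+1 + 1) * u j.+1 + u j.+2 <= - g * u j.+1].
Proof.
have [q [q01 qS qd]] := @strictly_superharmonic_exists _ a l a0 al.
have k0 : 0 < kappa by [].
have [|||D D0 mD] := @prod_le_geometric R a s.
- by [].
- exact: s0.
- by near=> n; near: n; apply: (cvgr_le _ al).
pose m n := \prod_(i < n) a i.
have m0 n : 0 < m n by apply: prodr_gt0.
have mS n : m n.+1 = m n * a n by rewrite /m big_ord_recr.
have cF : (fun n => a n / s - a n.+1 - (1 - s) + kappa / 2) @ \oo -->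
    l / s - l - (1 - s) + kappa / 2.
  apply: cvgD; last exact: cvg_cst.
  apply: cvgB; last exact: cvg_cst.
  apply: cvgB; last by rewrite (cvg_shiftS a).
  by apply: cvgM => //; exact: cvg_cst.
have L0 : l / s - l - (1 - s) + kappa / 2 < 0.
  have -> : l / s - l - (1 - s) + kappa / 2 = - (kappa / 2).
    by rewrite /kappa; field; rewrite gt_eqF.
  by rewrite oppr_lt0 divr_gt0.
pose f j := s ^+ j.+1 * (a j / s - a j.+1 - (1 - s) + kappa / 2).
pose d j := - (m j.+1 * (a j.+1 * (q j.+2 - q j.+1) - (q j.+1 - q j))).
have [||B B0 fB] := @eventually_le0_dominated R f d.
- by move=> n; rewrite /d oppr_gt0 pmulr_rlt0.
- near=> n; rewrite /f pmulr_rle0 ?exprn_gt0//.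
  by near: n; apply: (cvgr_le _ cF).
pose u k := s ^+ k + B * (m k * q k).
have BD0 : 0 < 1 + B * D by rewrite ltr_wpDr// mulr_ge0.
have u1 k : u k <= (1 + B * D) * s ^+ k.
  rewrite mulrDl mul1r lerD2l -mulrA ler_wpM2l//.
  have /andP[qk0 qk] := q01 k; apply: le_trans (mD k).
  by rewrite ler_piMr// ltW//; exact: m0.
exists (kappa / 2 / (1 + B * D)), (1 + B * D), u; split.
- by rewrite !divr_gt0.
- move=> k; rewrite u1 andbT lerDl mulr_ge0// mulr_ge0 ?(ltW (m0 _))//.
  by have /andP[] := q01 k.
- move=> j; apply: (@le_trans _ _ (- (kappa / 2 * s ^+ j.+1))).
    rewrite -subr_le0 (_ : _ - _ = f j - B * d j) ?subr_le0//.
    by rewrite /f /d /u !mS !exprS; field; rewrite gt_eqF.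
  rewrite mulNr lerN2 -[X in X <= _]mulrA.
  apply: ler_wpM2l; first by rewrite divr_ge0// ltW.
  by rewrite ler_pdivrMl.
Unshelve. all: by end_near. Qed.
End test_sequences.

(** * The exponential of a bounded linear operator *)

(** The remainder [f i] of the first-order expansion of [(t + h) ^+ i] satisfies
    [f i.+1 = (t + h) * f i + i * h ^+ 2 * t ^+ i.-1], which gives the bound by
    induction without any calculus. *)
Lemma taylor2_pow (R : realType) (t h r : R) i :
    `|t| <= r -> `|t + h| <= r ->
  `|(t + h) ^+ i.+2 - t ^+ i.+2 - i.+2%:R * h * t ^+ i.+1| <=
    (i.+2 * i.+1)%:R / 2 * h ^+ 2 * r ^+ i.
Proof.
move=> tr thr; have r0 : 0 <= r by rewrite (le_trans _ tr).
elim: i => [|i IHi].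
  rewrite expr0 mulr1 (_ : _ - _ = h ^+ 2); last by rewrite !expr2 expr1; ring.
  by rewrite ger0_norm ?sqr_ge0// divff// mul1r.
rewrite (_ : _ - _ = (t + h) *
   ((t + h) ^+ i.+2 - t ^+ i.+2 - i.+2%:R * h * t ^+ i.+1) +
   i.+2%:R * h ^+ 2 * t ^+ i.+1); last first.
  rewrite -[i.+3%:R]natr1 [t ^+ i.+3]exprS [(t + h) ^+ i.+3]exprS.
  by rewrite [t ^+ i.+2]exprS; ring.
rewrite (le_trans (ler_normD _ _))// [`|(t + h) * _|]normrM [`|_ * t ^+ _|]normrM.
apply: (@le_trans _ _ (r * ((i.+2 * i.+1)%:R / 2 * h ^+ 2 * r ^+ i) +
   i.+2%:R * h ^+ 2 * r ^+ i.+1)).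
  apply: lerD; first by apply: ler_pM.
  apply: ler_pM; rewrite ?mulr_ge0//.
    by rewrite ger0_norm// mulr_ge0// sqr_ge0.
  by rewrite normrX lerXn2r// nnegrE.
rewrite [r ^+ i.+1]exprS !natrM -[i.+3%:R]natr1 -[i.+2%:R]natr1.
by rewrite le_eqVlt; apply/orP; left; apply/eqP; field.
Qed.

(** Gives access to the theory of linear maps for a function that carries no
    canonical linear structure. *)
Lemma linear_fun_exists (R : pzRingType) (V : lmodType R) (A : V -> V) :
  linear A -> exists A' : {linear V -> V}, A = A' :> (V -> V).
Proof.
move=> lA.
by exists (HB.pack_for {linear V -> V} A (GRing.isLinear.Build R V V *:%R A lA)).
Qed.

Lemma exp_series_remainder (R : realType) (V : normedModType R) (A : V -> V)
    (v : V) (t h : R) n : linear A ->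
  exp_series A (t + h) v n.+2 - exp_series A t v n.+2
    - h *: A (exp_series A t v n.+1) =
  \sum_(0 <= i < n) (((t + h) ^+ i.+2 - t ^+ i.+2 - i.+2%:R * h * t ^+ i.+1)
    / (i.+2)`!%:R) *: iter i.+2 A v.
Proof.
move=> /linear_fun_exists[{}A ->]; rewrite /exp_series /series /=.
rewrite [A (\sum_(0 <= _ < _) _)]linear_sum scaler_sumr -sumrB.
rewrite big_nat_recl// [in X in _ - X]big_nat_recl//.
rewrite !big_nat_recl// !expr0 subrr add0r.
rewrite opprD addrACA -sumrB [X in X + _](_ : _ = 0) ?add0r.
  apply: eq_bigr => i _.
  rewrite [A (_ *: _)]linearZ/= scalerA -scalerBl -scalerBl; congr (_ *: _).
  have -> : (i.+2)`!%:R = i.+2%:R * (i.+1)`!%:R :> R by rewrite factS natrM.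
  have : (i.+1)`!%:R != 0 :> R by rewrite pnatr_eq0 -lt0n fact_gt0.
  have : i.+2%:R != 0 :> R by rewrite pnatr_eq0.
  move: (i.+2)%:R ((i.+1)`!)%:R => x y x0 y0.
  by field; rewrite x0 y0.
rewrite [A (_ *: _)]linearZ/= scalerA -scalerBl -scalerBl.
rewrite [X in X *: _](_ : _ = 0) ?scale0r//.
by rewrite /=; field.
Qed.

Lemma exp_taylor_coef_le (R : realType) (t h r : R) i :
    `|t| <= r -> `|t + h| <= r ->
  `|((t + h) ^+ i.+2 - t ^+ i.+2 - i.+2%:R * h * t ^+ i.+1) / (i.+2)`!%:R| <=
    h ^+ 2 / 2 * (r ^+ i / i`!%:R).
Proof.
move=> tr thr; rewrite normrM normfV normr_nat.
rewrite ler_pdivrMr ?ltr0n ?fact_gt0//; apply: le_trans (taylor2_pow _ tr thr) _.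
rewrite !factS !natrM le_eqVlt; apply/orP; left; apply/eqP; field.
by rewrite pnatr_eq0 -lt0n fact_gt0.
Qed.

Section exponential.
Variables (R : realType) (V : completeNormedModType R) (A : V -> V) (M : R).
Hypotheses (lA : linear A) (M0 : 0 <= M) (AM : forall v, `|A v| <= M * `|v|).

Lemma norm_iter_le v n : `|iter n A v| <= M ^+ n * `|v|.
Proof.
elim: n => [|n IHn]; first by rewrite mul1r.
by rewrite iterS (le_trans (AM _))// exprS -mulrA ler_wpM2l.
Qed.

Lemma exp_coeff_partial_le (r : R) n : 0 <= r ->
  \sum_(0 <= i < n) r ^+ i / i`!%:R <= expR r.
Proof.
move=> r0; apply: nondecreasing_cvgn_le (is_cvg_series_exp_coeff r) n.
by apply: nondecreasing_series => k _ _; exact: exp_coeff_ge0.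
Qed.

Lemma exp_series_cvg t v : cvgn (exp_series A t v).
Proof.
apply: normed_cvg; apply: (@series_le_cvg _ _
  (fun n => `|v| * exp_coeff (`|t| * M) n)).
- by move=> n /=.
- by move=> n; rewrite mulr_ge0// exp_coeff_ge0// mulr_ge0.
- move=> n /=; rewrite normrZ normrM normfV normr_nat normrX /exp_coeff/= exprMn.
  rewrite [leRHS](_ : _ = (`|t| ^+ n / n`!%:R) * (M ^+ n * `|v|)); last by ring.
  by rewrite ler_wpM2l ?norm_iter_le.
- by apply: is_cvg_seriesZ; exact: is_cvg_series_exp_coeff.
Qed.

Definition exp_op t v := limn (exp_series A t v).

Lemma bounded_linear_continuous : continuous A.
Proof.
have [A' AE] := linear_fun_exists lA.
move=> x; apply/cvgrPdist_le => e e0.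
have M1 : 0 < M + 1 by rewrite ltr_wpDl.
near=> y; rewrite AE -linearB -AE.
apply: (le_trans (AM _)); apply: (@le_trans _ _ ((M + 1) * `|x - y|)).
  by rewrite ler_wpM2r// lerDl.
rewrite -ler_pdivlMl//; near: y.
by apply: cvgr_dist_le; [exact: cvg_id|rewrite mulr_gt0// invr_gt0].
Unshelve. all: by end_near. Qed.

(** A quadratic error bound, uniform for [t] and [t + h] in a ball: it is the
    termwise Taylor bound summed against [`|iter n A v| <= M ^+ n * `|v|], and it
    contains differentiability in the norm of [V]. *)
Lemma exp_op_taylor (v : V) (t h r : R) : `|t| <= r -> `|t + h| <= r ->
  `|exp_op (t + h) v - exp_op t v - h *: A (exp_op t v)| <=
    h ^+ 2 * (M ^+ 2 / 2 * expR (r * M) * `|v|).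
Proof.
move=> tr thr; have r0 : 0 <= r by rewrite (le_trans _ tr).
have c2 u : exp_series A u v n.+2 @[n --> \oo] --> exp_op u v.
  rewrite (cvg_shiftS (fun n => exp_series A u v n.+1)).
  by rewrite (cvg_shiftS (exp_series A u v)); exact: exp_series_cvg.
have c1 u : A (exp_series A u v n.+1) @[n --> \oo] --> A (exp_op u v).
  apply: (cvg_comp _ A _ (@bounded_linear_continuous _)).
  by rewrite (cvg_shiftS (exp_series A u v)); exact: exp_series_cvg.
have : `|exp_series A (t + h) v n.+2 - exp_series A t v n.+2
    - h *: A (exp_series A t v n.+1)| @[n --> \oo] -->
   `|exp_op (t + h) v - exp_op t v - h *: A (exp_op t v)|.
  by apply: cvg_norm; apply: cvgB; [exact: cvgB|exact: cvgZr].
move=> cn; rewrite -(cvg_lim _ cn)//; apply: limr_le; first exact: cvgP cn.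
apply: nearW => n; rewrite exp_series_remainder//.
apply: (le_trans (ler_norm_sum _ _ _)).
apply: (@le_trans _ _ (\sum_(0 <= i < n)
    (h ^+ 2 * (M ^+ 2 / 2) * `|v|) * ((r * M) ^+ i / i`!%:R))).
  apply: ler_sum => i _; rewrite normrZ.
  apply: (@le_trans _ _ (h ^+ 2 / 2 * (r ^+ i / i`!%:R) * (M ^+ i.+2 * `|v|))).
    by apply: ler_pM => //; [exact: exp_taylor_coef_le|exact: norm_iter_le].
  rewrite exprMn !exprS le_eqVlt; apply/orP; left; apply/eqP; field.
  by rewrite pnatr_eq0 -lt0n fact_gt0.
rewrite -mulr_sumr.
rewrite [leRHS](_ : _ = h ^+ 2 * (M ^+ 2 / 2) * `|v| * expR (r * M)); last by ring.
apply: ler_wpM2l; last by apply: exp_coeff_partial_le; exact: mulr_ge0.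
by rewrite mulr_ge0// mulr_ge0 ?sqr_ge0// divr_ge0// sqr_ge0.
Qed.

Lemma exp_op_solution v : is_ode_solution A v (exp_op ^~ v).
Proof.
split=> [|t t0].
  apply/cvg_lim => //; rewrite -(cvg_shiftS (exp_series A 0 v)).
  apply: (@cvg_trans _ (cst v @ \oo)); last exact: cvg_cst.
  apply: near_eq_cvg; near=> n; rewrite /= /exp_series /series /=.
  rewrite big_nat_recl// big1 ?addr0 ?expr0 ?fact0 ?divr1 ?scale1r// => i _.
  by rewrite expr0n/= mul0r scale0r.
apply: cvg_within_filter.
set C := M ^+ 2 / 2 * expR ((`|t| + 1) * M) * `|v|.
have C0 : 0 <= C by rewrite !mulr_ge0// ?sqr_ge0 ?expR_ge0.
apply/cvgrPdist_le => e e0.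
have C1 : 0 < C + 1 by rewrite ltr_wpDl.
near=> h.
have h0 : h != 0 by near: h; exact: nbhs_dnbhs_neq.
have h1 : `|h| <= 1.
  by near: h; apply: dnbhs0_le.
have he : `|h| <= e / (C + 1).
  by near: h; apply: dnbhs0_le; rewrite divr_gt0.
rewrite distrC.
rewrite [X in `|X|](_ : _ =
    h^-1 *: (exp_op (t + h) v - exp_op t v - h *: A (exp_op t v))).
  rewrite normrZ normfV ler_pdivrMl ?normr_gt0//.
  apply: (le_trans (@exp_op_taylor v t h (`|t| + 1) _ _)).
  - by rewrite lerDl.
  - by rewrite (le_trans (ler_normD _ _))// lerD2l.
  rewrite -/C -(real_normK (num_real h)) expr2 -mulrA; apply: ler_wpM2l => //.
  rewrite ler_pdivlMr// in he; apply: le_trans he.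
  by rewrite ler_wpM2l// lerDl.
by rewrite [in RHS]scalerBr scalerA mulVf// scale1r.
Unshelve. all: by end_near. Qed.

End exponential.

Lemma is_ode_solutionB (R : realType) (V : normedModType R) (A : V -> V)
    (v0 v1 : V) (y z : R -> V) : linear A ->
  is_ode_solution A v0 y -> is_ode_solution A v1 z ->
  is_ode_solution A (v0 - v1) (fun t => y t - z t).
Proof.
move=> /linear_fun_exists[A' ->] [y0 ys] [z0 zs]; split; first by rewrite y0 z0.
move=> t t0; set F := within _ _.
have c : h^-1 *: (y (t + h) - y t) - h^-1 *: (z (t + h) - z t) @[h --> F]
    --> A' (y t - z t).
  by rewrite linearB; exact: cvgB (ys t t0) (zs t t0).
apply: cvg_trans c; apply: near_eq_cvg; apply: nearW => h /=.
by rewrite -scalerBr; congr (_ *: _); rewrite opprD addrACA -opprD.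
Qed.

(** * Weighted inner products on the sequence space *)

(** The bilinear form with weights [w k], [k >= 1]; the index is shifted as in
    [l2g_term]. *)
Definition l2w (R : realType) (w : nat -> R) (x y : nat -> R) : R :=
  limn (series (fun k => w k.+1 * x k.+1 * y k.+1)).

Section weighted_product.
Variables (R : realType) (theta : {posnum R}) (w : nat -> R) (M : R).
Hypotheses (w0 : forall k, 0 <= w k) (wM : forall k, w k <= M * theta%:num ^- k).
Implicit Types x y z : L2g theta.

(* The parameter r is set to 1 for convergence, and to the ratio of the norms,
   where the bound is sharp, for the Cauchy-Schwarz inequality. *)
Let l2w_term_le (r : R) x y k : 0 < r ->
  `|w k.+1 * x k.+1 * y k.+1| <=
  M * (r * l2g_term theta x k + r^-1 * l2g_term theta y k) / 2.
Proof.
move=> r0; rewrite -mulrA normrM ger0_norm//.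
apply: (@le_trans _ _ (M * theta%:num ^- k.+1 * `|x k.+1 * y k.+1|)).
  by rewrite ler_wpM2r.
have Mt : 0 <= M * theta%:num ^- k.+1 by rewrite (le_trans (w0 k.+1)).
rewrite /l2g_term.
rewrite [leRHS](_ : _ = M * theta%:num ^- k.+1 *
    ((r * x k.+1 ^+ 2 + r^-1 * y k.+1 ^+ 2) / 2)); last by ring.
apply: ler_wpM2l => //; rewrite ler_pdivlMr// normrM.
rewrite -(real_normK (num_real (x _))) -(real_normK (num_real (y _))).
set b := `|x _|; set c := `|y _|.
rewrite -subr_ge0 [leRHS](_ : _ = r^-1 * (r * b - c) ^+ 2).
  by rewrite mulr_ge0 ?sqr_ge0// invr_ge0 ltW.
by field; rewrite gt_eqF.
Qed.

Lemma weight_bound_ge0 : 0 <= M.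
Proof. by have := le_trans (w0 0%N) (wM 0%N); rewrite expr0 invr1 mulr1. Qed.

Lemma l2w_cvg x y : cvgn (series (fun k => w k.+1 * x k.+1 * y k.+1)).
Proof.
apply: normed_cvg.
apply: (@series_le_cvg _ _ (fun k => (M / 2) * (l2g_term theta x + l2g_term theta y) k)).
- by move=> n /=.
- move=> n; rewrite mulr_ge0// ?divr_ge0 ?weight_bound_ge0//.
  by rewrite addr_ge0 ?l2g_term_ge0.
- move=> n /=; apply: (le_trans (@l2w_term_le 1 x y n ltr01)).
  by rewrite invr1 !mul1r mulrAC.
- apply: is_cvg_seriesMl.
  by apply: is_cvg_seriesD; exact: l2g_seq_cvg.
Qed.

Lemma l2wC x y : l2w w x y = l2w w y x.
Proof. by congr (limn (series _)); apply/funext => k; rewrite mulrAC. Qed.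

Lemma l2wDr x y z : l2w w x (y + z) = l2w w x y + l2w w x z.
Proof.
rewrite /l2w -lim_seriesD; [|exact: l2w_cvg|exact: l2w_cvg]; congr (limn (series _)).
by apply/funext => k; rewrite l2g_seqD mulrDr.
Qed.

Lemma l2wZr a x y : l2w w x (a *: y) = a * l2w w x y.
Proof.
rewrite /l2w -[RHS](lim_seriesZ _ (@l2w_cvg x y)); congr (limn (series _)).
by apply/funext => k; rewrite l2g_seqZ mulrCA.
Qed.

Lemma l2wBr x y z : l2w w x (y - z) = l2w w x y - l2w w x z.
Proof. by rewrite l2wDr -scaleN1r l2wZr mulN1r. Qed.

Lemma l2wDl x y z : l2w w (x + y) z = l2w w x z + l2w w y z.
Proof. by rewrite l2wC l2wDr !(l2wC z). Qed.

Lemma l2wBl x y z : l2w w (x - y) z = l2w w x z - l2w w y z.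
Proof. by rewrite l2wC l2wBr !(l2wC z). Qed.

Lemma l2w_CauchySchwarz x y : `|l2w w x y| <= M * `|x| * `|y|.
Proof.
have z0 z : l2w w z (0 : L2g theta) = 0.
  by rewrite -[0 : L2g theta](scale0r z) l2wZr mul0r.
have [->|x0] := eqVneq x 0.
  by rewrite l2wC z0 normr0 !mulr_ge0// weight_bound_ge0.
have [->|y0] := eqVneq y 0.
  by rewrite z0 normr0 !mulr_ge0// weight_bound_ge0.
have nx : 0 < `|x| by rewrite normr_gt0.
have ny : 0 < `|y| by rewrite normr_gt0.
rewrite -lim_norm; last exact: l2w_cvg.
apply: limr_le; first by apply: is_cvg_norm; exact: l2w_cvg.
apply: nearW => n; apply: (le_trans (ler_norm_sum _ _ _)).
apply: (@le_trans _ _ (\sum_(0 <= k < n) (M * (`|y| / `|x| * l2g_term theta x k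
    + (`|y| / `|x|)^-1 * l2g_term theta y k) / 2))).
  by apply: ler_sum => k _; apply: l2w_term_le; rewrite divr_gt0.
rewrite -mulr_suml -mulr_sumr big_split/= -!mulr_sumr.
apply: (@le_trans _ _ (M * (`|y| / `|x| * `|x| ^+ 2 +
    (`|y| / `|x|)^-1 * `|y| ^+ 2) / 2)).
  apply: ler_wpM2r => //; apply: ler_wpM2l; first exact: weight_bound_ge0.
  apply: lerD; (apply: ler_wpM2l; first by rewrite ?invr_ge0 divr_ge0).
    by rewrite [in leRHS]/Num.norm/= l2g_normK l2g_lim_ge.
  by rewrite [in leRHS]/Num.norm/= l2g_normK l2g_lim_ge.
rewrite le_eqVlt; apply/orP; left; apply/eqP; field.
by rewrite !gt_eqF.
Qed.

Lemma l2w_ge0 x : 0 <= l2w w x x.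
Proof.
apply: limr_ge; first exact: l2w_cvg.
apply: nearW => n; apply: sumr_ge0 => k _.
by rewrite -mulrA mulr_ge0// -expr2 sqr_ge0.
Qed.

Lemma l2w_le_norm x : l2w w x x <= M * `|x| ^+ 2.
Proof.
by rewrite expr2 mulrA (le_trans (ler_norm _))// l2w_CauchySchwarz.
Qed.

Lemma norm_le_l2w (m : R) x : (forall k, theta%:num ^- k <= m * w k) ->
  `|x| ^+ 2 <= m * l2w w x x.
Proof.
move=> wm.
rewrite [in leLHS]/Num.norm/= l2g_normK.
rewrite -[leRHS](lim_seriesZ m (@l2w_cvg x x)).
apply: lim_series_le.
- exact: l2g_seq_cvg.
- by apply: is_cvg_seriesZ; exact: l2w_cvg.
move=> n; rewrite /l2g_term -[leRHS]/(m * (w n.+1 * x n.+1 * x n.+1)).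
rewrite -mulrA -expr2 mulrA mulrC.
by rewrite ler_wpM2r// sqr_ge0.
Qed.

Lemma l2w_cvg2 (T : Type) (F : set_system T) (FF : Filter F)
    (f g : T -> L2g theta) x y :
  f @ F --> x -> g @ F --> y -> l2w w (f t) (g t) @[t --> F] --> l2w w x y.
Proof.
move=> fx gy; apply/subr_cvg0/norm_cvg0P.
apply: (@squeeze_cvgr _ F _ _ (fun=> 0) (fun t =>
   M * `|f t - x| * `|g t| + M * `|x| * `|g t - y|)).
- apply: nearW => t; rewrite normr_ge0/=.
  rewrite (_ : _ - _ = l2w w (f t - x) (g t) + l2w w x (g t - y)).
    by rewrite (le_trans (ler_normD _ _))// lerD ?l2w_CauchySchwarz.
  by rewrite l2wBl l2wBr addrA subrK.
- exact: cvg_cst.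
- rewrite [X in _ --> X](_ : _ = M * 0 * `|y| + M * `|x| * 0);
    last by rewrite !mulr0 mul0r addr0.
  apply: cvgD; apply: cvgM.
  + apply: cvgM; first exact: cvg_cst.
    by apply/norm_cvg0P/subr_cvg0.
  + exact: cvg_norm.
  + exact: cvg_cst.
  + by apply/norm_cvg0P/subr_cvg0.
Qed.

(** The product rule for [l2w w (y t) (y t)], over any filter [F] finer than the
    punctured neighborhoods of [0]; this covers both the two-sided limits at
    [t > 0] and the one-sided limit at [t = 0]. *)
Lemma l2w_quotient_cvg (F : set_system R) (FF : Filter F) (y : R -> L2g theta)
    (t : R) (d : L2g theta) :
  (forall P, 0^' P -> F P) ->
  h^-1 *: (y (t + h) - y t) @[h --> F] --> d ->
  y (t + h) @[h --> F] --> y t /\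
  h^-1 * (l2w w (y (t + h)) (y (t + h)) - l2w w (y t) (y t)) @[h --> F] -->
    2 * l2w w (y t) d.
Proof.
move=> F0 cd.
have nz : \forall h \near F, h != 0.
  have nz0 : \forall h \near (0 : R)^', h != 0 by exact: nbhs_dnbhs_neq.
  exact: F0 nz0.
have h0 : h @[h --> F] --> (0 : R).
  by move=> P P0; apply: F0; apply: nbhs_dnbhs.
have cy : y (t + h) @[h --> F] --> y t.
  have c : y t + h *: (h^-1 *: (y (t + h) - y t)) @[h --> F] --> y t + 0 *: d.
    by apply: cvgD; [exact: cvg_cst|exact: cvgZ h0 cd].
  rewrite scale0r addr0 in c; apply: cvg_trans c; apply: near_eq_cvg.
  near=> h; rewrite scalerA mulfV ?scale1r; first by rewrite addrC subrK.
  by near: h.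
split=> //.
have : l2w w (y (t + h) + y t) (h^-1 *: (y (t + h) - y t)) @[h --> F] -->
    l2w w (y t + y t) d.
  by apply: l2w_cvg2 => //; apply: cvgD => //; exact: cvg_cst.
rewrite -[y t + y t]mulr2n -scaler_nat l2wC l2wZr [l2w w d _]l2wC => c.
apply: cvg_trans c; apply: near_eq_cvg; apply: nearW => h.
by rewrite l2wZr l2wDl !l2wBr; rewrite [l2w w (y t) (y (t + h))]l2wC; ring.
Unshelve. all: by end_near. Qed.

Section decay.
Variables (A : L2g theta -> L2g theta) (g : R).
Hypothesis (Ag : forall x, l2w w x (A x) <= - g * l2w w x x).

(** Gronwall's inequality for the weighted energy: [expR (2 * g * t)] times the
    energy of [y t] has a nonpositive derivative. Being valid for every
    solution, and not only for the exponential, it yields uniqueness as well as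
    the decay rate. *)
Lemma l2w_decay v (y : R -> L2g theta) (t : R) :
  is_ode_solution A v y -> 0 <= t ->
  l2w w (y t) (y t) <= expR (- (2 * g * t)) * l2w w v v.
Proof.
move=> [yv sol] t0.
pose E s := l2w w (y s) (y s).
pose G := (fun s : R => expR (2 * g * s) * E s) : R -> R.
have dE (s : R) : 0 < s -> is_derive s 1 E (2 * l2w w (y s) (A (y s))).
  move=> s0.
  have [] := @l2w_quotient_cvg 0^' _ y s (A (y s)) => //.
    apply: cvg_trans (sol s (ltW s0)) => P/= WP.
    have ss : \forall h \near 0^', 0 <= s + h.
      near=> h; have : `|h| <= s by near: h; exact: dnbhs0_le.
      by rewrite ler_norml => /andP[+ _]; rewrite -lerBlDl sub0r.
    have WP' : \forall h \near 0^', 0 <= s + h ->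
      P (h^-1 *: (y (s + h) - y s)) := WP.
    by apply: filterS2 WP' ss => h hP /hP.
  move=> _ cq.
  have cE : (fun h => h^-1 *: ((E \o shift s) (h *: 1) - E s)) @ 0^' -->
      2 * l2w w (y s) (A (y s)).
    apply: cvg_trans cq; apply: near_eq_cvg; apply: nearW => h.
    by rewrite /= /shift /= scaler1 [h + s]addrC.
  split; first exact: cvgP cE.
  exact: cvg_lim cE.
have dexp (s : R) : is_derive s 1 (fun s : R => expR (2 * g * s))
    (2 * g * expR (2 * g * s)).
  rewrite [2 * g * expR _]mulrC; apply: is_derive1_comp.
  by apply: is_derive_eq; rewrite scaler1.
have dG (s : R) : 0 < s -> is_derive s 1 G
    (expR (2 * g * s) * (2 * (g * E s + l2w w (y s) (A (y s))))).
  move=> s0; have := dE s s0 => dEs.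
  have dexps := dexp s.
  apply: is_derive_eq; rewrite /GRing.scale/=; ring.
have G0 : {within `[0, +oo[, continuous G}.
  apply/continuous_within_itvcyP; split.
    move=> s; rewrite in_itv/= andbT => s0.
    apply: differentiable_continuous; apply/derivable1_diffP.
    by have := dG s s0 => -[].
  have [] := @l2w_quotient_cvg (0 : R)^'+ _ y 0 (A (y 0)).
  - move=> P P0.
    have P0' : \forall h \near (0 : R), h != 0 -> P h := P0.
    suff : \forall h \near (0 : R), 0 < h -> P h by [].
    by apply: filterS P0' => h hP h0; apply: hP; rewrite gt_eqF.
  - apply: cvg_trans (sol 0 (lexx _)) => P /= WP.
    have WP' : \forall h \near (0 : R), h != 0 -> 0 <= 0 + h ->
      P (h^-1 *: (y (0 + h) - y 0)) := WP.
    suff : \forall h \near (0 : R), 0 < h -> P (h^-1 *: (y (0 + h) - y 0)) by [].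
    apply: filterS WP' => h hP h0; apply: hP; first by rewrite gt_eqF.
    by rewrite add0r ltW.
  move=> cy _.
  have cE : E s @[s --> 0^'+] --> E 0.
    have ycvg : y h @[h --> 0^'+] --> y 0.
      by apply: cvg_trans cy; apply: near_eq_cvg; apply: nearW => h /=;
        rewrite add0r.
    exact: l2w_cvg2.
  have ce : {for (0 : R), continuous (fun s : R => expR (2 * g * s))}.
    apply: differentiable_continuous; apply/derivable1_diffP.
    by have := dexp 0 => -[].
  by apply: cvgM cE; exact: cvg_at_right_filter ce.
have dG0 (s : R) : s \in `]0, +oo[ -> derive1 G s <= 0.
  rewrite in_itv/= andbT => s0.
  rewrite derive1E (@derive_val _ _ _ _ _ _ _ (dG s s0)).
  rewrite pmulr_rle0 ?expR_gt0// pmulr_rle0// -lerBrDl sub0r -mulNr.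
  exact: Ag.
have Gd (s : R) : s \in `]0, +oo[ -> derivable G s 1.
  by rewrite in_itv/= andbT => /dG -[].
have := @ler0_derive1_nincry R G 0 Gd dG0 G0 0 t (lexx _) t0.
rewrite /G mulr0 expR0 mul1r {2}/E yv.
by rewrite expRN ler_pdivlMl ?expR_gt0.
Unshelve. all: by end_near. Qed.
End decay.
End weighted_product.

(** * Energy dissipation of the birth-death operator *)

Section birth_death_energy.
Variables (R : realFieldType) (a p u : nat -> R) (g h : R).
Hypotheses (a0 : forall k, 0 < a k) (p0 : forall k, 0 < p k).
Hypothesis u0 : forall k, 0 < u k.
Hypothesis pg : forall j,
  a j.+1 * (p j.+2 - p j.+1) - (p j.+1 - p j) <= - g * p j.+1.
Hypothesis uh : forall j,
  a j * u j - (a j.+1 + 1) * u j.+1 + u j.+2 <= - h * u j.+1.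

(** The dissipation inequality, up to the flux through rank [n]. Writing
    [x = u * y], the cross terms [y k * y k.+1] are bounded by half the sum of
    the squares. Half of what remains of [y k.+1 ^+ 2] is controlled by the
    inequality on [u]; the other half is, after a discrete integration by parts
    with flux [T], controlled by the inequality on [p]. *)
Lemma energy_flux_le (x : nat -> R) n : x 0%N = 0 ->
  \sum_(0 <= k < n) (p k.+1 / u k.+1 * x k.+1 *
      (a k * x k - (a k.+1 + 1) * x k.+1 + x k.+2)
    + (g + h) / 2 * (p k.+1 / u k.+1 * x k.+1 * x k.+1)) <=
  p n * (x n.+1 ^+ 2 / u n.+1) / 2.
Proof.
move=> x0.
pose T k := p k * (x k.+1 ^+ 2 / u k.+1) - p k.+1 * a k * (x k ^+ 2 / u k).
have e0 k : 0 <= x k ^+ 2 / u k by rewrite divr_ge0 ?sqr_ge0// ltW.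
apply: (@le_trans _ _ (T n / 2)); last first.
  rewrite ler_wpM2r// /T gerBl; rewrite mulr_ge0// mulr_ge0// ltW//.
elim: n => [|n IHn].
  rewrite big_geq// /T x0 expr0n/= mul0r mulr0 subr0.
  by rewrite divr_ge0// mulr_ge0// ltW.
rewrite big_nat_recr//= (le_trans (lerD IHn (lexx _)))//.
rewrite -lerBrDl -mulrBl.
pose X := x n / u n; pose Y := x n.+1 / u n.+1; pose Z := x n.+2 / u n.+2.
have xX : x n = u n * X by rewrite mulrC divfK// gt_eqF.
have xY : x n.+1 = u n.+1 * Y by rewrite mulrC divfK// gt_eqF.
have xZ : x n.+2 = u n.+2 * Z by rewrite mulrC divfK// gt_eqF.
rewrite /T xX xY xZ.
have := pg n; have := uh n.
have := u0 n; have := u0 n.+1; have := u0 n.+2.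
have := p0 n.+1; have := a0 n.
move: (u n) (u n.+1) (u n.+2) (p n) (p n.+1) (p n.+2) (a n) (a n.+1) X Y Z
  {xX xY xZ IHn} => U V W P Q S A B X Y Z A0 Q0 W0 V0 U0 hu hp.
(* The exact remainder: two squares lost in the cross terms, and the slack of the
   two hypotheses. *)
rewrite -subr_ge0.
rewrite [leRHS](_ : _ = (Q * A * U * (X - Y) ^+ 2 + Q * W * (Z - Y) ^+ 2
   + Q * Y ^+ 2 * (- h * V - (A * U - (B + 1) * V + W))
   + V * Y ^+ 2 * (- g * Q - (B * (S - Q) - (Q - P)))) / 2); last first.
  by field; rewrite !gt_eqF.
move/ltW: A0 => A0; move/ltW: Q0 => Q0; move/ltW: U0 => U0.
move/ltW: V0 => V0; move/ltW: W0 => W0.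
rewrite -subr_ge0 in hp; rewrite -subr_ge0 in hu.
have QA := mulr_ge0 Q0 A0; have QAU := mulr_ge0 QA U0; have QW := mulr_ge0 Q0 W0.
have QY := mulr_ge0 Q0 (sqr_ge0 Y); have VY := mulr_ge0 V0 (sqr_ge0 Y).
rewrite divr_ge0// !addr_ge0//; first exact: mulr_ge0 QAU (sqr_ge0 _).
- exact: mulr_ge0 QW (sqr_ge0 _).
- exact: mulr_ge0 QY hu.
- exact: mulr_ge0 VY hp.
Qed.

End birth_death_energy.

Section operator.
Variables (R : realType) (theta : {posnum R}) (alpha beta : R) (L : nat).
Hypotheses (alpha0 : 0 < alpha) (beta0 : 0 < beta) (rho1 : alpha / beta < 1).
Local Notation rho := (alpha / beta).
Local Notation a := (fun k : nat => L%:R * rho ^+ (L ^ k)).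
Local Notation K := (@Kop R theta alpha beta L).

Let rho0 : 0 < rho. Proof. by rewrite divr_gt0. Qed.

(** After division by [beta], the operator is the forward equation of a
    birth-death chain with birth rates [a k] and death rate [1], absorbed at
    [0]. *)
Lemma KopS (x : L2g theta) k :
  K x k.+1 = beta * (a k * x k - (a k.+1 + 1) * x k.+1 + x k.+2).
Proof. by rewrite Kop_val//=; ring. Qed.

Lemma Kop_linear : linear (K : L2g theta -> L2g theta).
Proof.
move=> c x y; apply/val_inj/funext => -[|k].
  by rewrite [LHS]l2g_seq0 [RHS]l2g_seq0.
rewrite -[LHS]/(K (c *: x + y) k.+1) -[RHS]/(c * K x k.+1 + K y k.+1).
rewrite !KopS -![(c *: x + y) _]/(c * x _ + y _); ring.
Qed.

Lemma Kop_bounded :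
  exists2 N, 0 <= N & forall x : L2g theta, `|K x| <= N * `|x|.
Proof.
have a_ge0 k : 0 <= a k by rewrite mulr_ge0// exprn_ge0// ltW.
have a_le k : a k <= L%:R.
  by rewrite ler_piMr// exprn_ile1// ltW.
have sqM (c d y : R) : 0 <= c -> c <= d -> (c * y) ^+ 2 <= (d * y) ^+ 2.
  move=> c_ge0 cd; rewrite !exprMn ler_wpM2r ?sqr_ge0// lerXn2r ?nnegrE//.
  exact: le_trans cd.
pose N2 := 3 * beta ^+ 2 *
  (L%:R ^+ 2 * theta%:num^-1 + (L%:R + 1) ^+ 2 + theta%:num).
have N20 : 0 <= N2.
  apply: mulr_ge0; first by rewrite mulr_ge0 ?sqr_ge0.
  exact: addr_ge0.
exists (Num.sqrt N2) => [|x]; first exact: sqrtr_ge0.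
apply: l2g_norm_le => [|n]; first by rewrite mulr_ge0 ?sqrtr_ge0.
rewrite exprMn sqr_sqrtr//.
pose t := l2g_term theta x.
have t0 k : 0 <= t k by exact: l2g_term_ge0.
pose b k := if k is j.+1 then t j else 0.
have tx k : x k.+1 ^+ 2 * theta%:num ^- k.+1 = t k by [].
have bx k : x k ^+ 2 * theta%:num ^- k = b k.
  by case: k => [|k//]; rewrite l2g_seq0 expr0n/= mul0r.
have Kt k : l2g_term theta (K x) k <= 3 * beta ^+ 2 *
    (L%:R ^+ 2 * theta%:num^-1 * b k + (L%:R + 1) ^+ 2 * t k + theta%:num * t k.+1).
  have -> : L%:R ^+ 2 * theta%:num^-1 * b k = (L%:R * x k) ^+ 2 * theta%:num ^- k.+1.
    by rewrite -bx [_ ^+ k.+1]exprS invfM; ring.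
  have -> : theta%:num * t k.+1 = x k.+2 ^+ 2 * theta%:num ^- k.+1.
    by rewrite -tx [_ ^+ k.+2]exprS invfM mulrCA mulVKf// gt_eqF.
  rewrite -tx [leRHS](_ : _ = beta ^+ 2 * (3 * ((L%:R * x k) ^+ 2 +
     ((L%:R + 1) * x k.+1) ^+ 2 + x k.+2 ^+ 2)) * theta%:num ^- k.+1); last by ring.
  rewrite /l2g_term KopS exprMn; apply: ler_wpM2r; first by rewrite invr_ge0 exprn_ge0.
  apply: ler_wpM2l; first exact: sqr_ge0.
  apply: (@le_trans _ _ (3 * ((a k * x k) ^+ 2 +
    ((a k.+1 + 1) * x k.+1) ^+ 2 + x k.+2 ^+ 2))).
    move: (a k * x k) ((a k.+1 + 1) * x k.+1) (x k.+2) => X Y Z.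
    by have := sqr_ge0 (X + Y); have := sqr_ge0 (X - Z);
      have := sqr_ge0 (Y + Z); nra.
  apply: ler_wpM2l => //; rewrite lerD2r; apply: lerD; apply: sqM => //.
  - by rewrite addr_ge0.
  - by rewrite lerD2r.
apply: (@le_trans _ _ (\sum_(0 <= k < n) (3 * beta ^+ 2 *
    (L%:R ^+ 2 * theta%:num^-1 * b k + (L%:R + 1) ^+ 2 * t k + theta%:num * t k.+1)))).
  by apply: ler_sum => k _; exact: Kt.
rewrite -mulr_sumr !big_split/= -!mulr_sumr.
have S n' : \sum_(0 <= k < n') t k <= `|x| ^+ 2.
  by rewrite [in leRHS]/Num.norm/= l2g_normK l2g_lim_ge.
rewrite /N2 -[leRHS]mulrA; apply: ler_wpM2l; first by rewrite mulr_ge0 ?sqr_ge0.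
rewrite [leRHS]mulrDl [X in _ <= X + _]mulrDl.
apply: lerD; first apply: lerD.
- apply: ler_wpM2l; first by rewrite mulr_ge0 ?sqr_ge0.
  apply: le_trans (S n); case: n => [|n]; first by rewrite !big_geq.
  by rewrite big_nat_recl//= add0r big_nat_recr//= lerDl.
- by apply: ler_wpM2l; rewrite ?sqr_ge0.
- apply: ler_wpM2l => //; apply: le_trans (S n.+1).
  by rewrite big_nat_recl//= lerDr.
Qed.

(** Letting the rank tend to infinity in [energy_flux_le]: as [p] is
    nondecreasing, the flux is at most a term of the convergent series of
    [l2w w x x], hence vanishes in the limit. *)
Lemma Kop_energy_le (p u : nat -> R) (g h M : R) :
    (0 < L)%N ->
    (forall k, 0 < p k) -> (forall k, 0 < u k) -> (forall k, p k <= p k.+1) ->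
    (forall k, p k / u k <= M * theta%:num ^- k) ->
    (forall j, a j.+1 * (p j.+2 - p j.+1) - (p j.+1 - p j) <= - g * p j.+1) ->
    (forall j, a j * u j - (a j.+1 + 1) * u j.+1 + u j.+2 <= - h * u j.+1) ->
  forall x : L2g theta,
  l2w (fun k => p k / u k) x (K x) <=
    - (beta * ((g + h) / 2)) * l2w (fun k => p k / u k) x x.
Proof.
move=> L0 p0 u0 pS wM pg uh x; set w := (fun k => p k / u k).
have w0 k : 0 <= w k by rewrite divr_ge0// ltW.
have a0 k : 0 < a k by rewrite mulr_gt0 ?ltr0n ?exprn_gt0.
have cw := @l2w_cvg R theta w M w0 wM.
rewrite mulNr -subr_le0 opprK.
rewrite -[X in _ + X <= _](lim_seriesZ (beta * ((g + h) / 2)) (cw x x)) -lim_seriesD;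
  [|exact: cw|by apply: is_cvg_seriesZ; exact: cw].
have c0 : beta * (w n.+1 * x n.+1 * x n.+1 / 2) @[n --> \oo] --> 0.
  rewrite -[X in _ --> X](mulr0 beta); apply: cvgM; first exact: cvg_cst.
  rewrite -[X in _ --> X](mul0r 2^-1); apply: cvgM; last exact: cvg_cst.
  exact: cvg_series_cvg_0 (cw x x).
rewrite -(cvg_lim _ c0)//; apply: ler_lim.
- by apply: is_cvg_seriesD; [exact: cw|apply: is_cvg_seriesZ; exact: cw].
- exact: cvgP c0.
apply: nearW => n.
have := energy_flux_le a0 p0 u0 pg uh n (l2g_seq0 x).
rewrite -(ler_pM2l beta0) mulr_sumr => E.
apply: (le_trans (le_trans _ E)).
  rewrite le_eqVlt; apply/orP; left; apply/eqP.
  apply: eq_bigr => k _.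
  rewrite -[LHS]/(w k.+1 * x k.+1 * K x k.+1 +
    beta * ((g + h) / 2) * (w k.+1 * x k.+1 * x k.+1)).
  by rewrite KopS /w; ring.
rewrite ler_pM2l// ler_pM2r// /w.
rewrite [leRHS](_ : _ = p n.+1 * (x n.+1 ^+ 2 / u n.+1)); last by ring.
by rewrite ler_wpM2r// divr_ge0 ?sqr_ge0// ltW.
Qed.

End operator.

(** * Exponential stability *)

Lemma cvg_rates (R : realType) (rho : R) (L : nat) : 0 < rho < 1 ->
  (1 < L)%N -> L%:R * rho ^+ (L ^ n) @[n --> \oo] --> 0.
Proof.
move=> /andP[r0 r1] L1; rewrite -[X in _ --> X](mulr0 L%:R).
apply: cvgM; first exact: cvg_cst.
apply: (@squeeze_cvgr _ _ _ _ (fun=> 0) (fun n => rho ^+ n)).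
- apply: nearW => n; rewrite exprn_ge0 ?(ltW r0)//=.
  by apply: ler_wiXn2l; [exact: ltW|exact: ltW|exact: ltnW (ltn_expl n L1)].
- exact: cvg_cst.
- by apply: cvg_expr; rewrite ger0_norm// ltW.
Qed.

Unset Implicit Arguments.

Theorem theorem2p6 (R : realType) (alpha beta : R) (L : nat)
    (theta : {posnum R})
    (alpha_gt0 : 0 < alpha) (beta_gt0 : 0 < beta) (rho_lt1 : alpha / beta < 1)
    (L_ge1 : (1 <= L)%N)
    (theta_range : ((2 <= L)%N /\ 0 < theta%:num < 1) \/
                   (L = 1%N /\ alpha / beta <= theta%:num < 1)) :
  exists gamma C : R, 0 < gamma /\
    forall z0 : L2g theta, exists z : R -> L2g theta,
      [/\ forall t, 0 <= t ->
            exp_series (Kop alpha beta L) t z0 n @[n --> \oo] --> z t,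
          is_ode_solution (Kop alpha beta L) z0 z,
          forall y, is_ode_solution (Kop alpha beta L) z0 y ->
            forall t, 0 <= t -> y t = z t &
          forall t, 0 <= t -> `|z t| <= expR (- gamma * t) * C * `|z0|].
Proof.
have rho_gt0 : 0 < alpha / beta by rewrite divr_gt0.
pose a k : R := L%:R * (alpha / beta) ^+ (L ^ k).
have a_gt0 k : 0 < a k by rewrite mulr_gt0 ?ltr0n ?exprn_gt0.
have th1 : theta%:num < 1 by case: theta_range => -[_ /andP[]].
pose s := Num.sqrt theta%:num.
have s0 : 0 < s by rewrite sqrtr_gt0.
have ss : s * s = theta%:num by rewrite -expr2 sqr_sqrtr.
have s1 : s < 1 by rewrite -sqrtr1 ltr_sqrt.
(* For L = 1 the rates are constantly rho, and rho <= theta = s ^+ 2 < s. *)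
have [l al ls] : exists2 l : R, a @ \oo --> l & l < s.
  case: theta_range => [[L2 _]|[L1 /andP[rt _]]].
    by exists 0 => //; apply: cvg_rates => //; rewrite rho_gt0.
  exists (alpha / beta).
    have -> : a = fun=> alpha / beta.
      by apply/funext => k; rewrite /a L1 exp1n expr1 mul1r.
    exact: cvg_cst.
  by apply: (le_lt_trans rt); rewrite -ss gtr_pMr.
have [g1 [C1 [p [g10 pC pS pg]]]] :=
  dual_supersolution_exists a_gt0 al ls s0 s1.
have [g2 [C2 [u [g20 uC ug]]]] := supersolution_exists a_gt0 al ls s0 s1.
have sk k : 0 < s ^+ k by rewrite exprn_gt0.
have p0 k : 0 < p k.
  by have /andP[+ _] := pC k; apply: lt_le_trans; rewrite invr_gt0.
have u0 k : 0 < u k by have /andP[+ _] := uC k; apply: lt_le_trans.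
(* The contracting norm: its weights p / u are of the order of
   s ^- k / s ^+ k = theta ^- k. *)
pose w k := p k / u k.
have w0 k : 0 <= w k by rewrite divr_ge0// ltW.
have thk k : theta%:num ^- k = s ^- k * s ^- k by rewrite -ss exprMn invfM.
have wC1 k : w k <= C1 * theta%:num ^- k.
  have /andP[_ pk] := pC k; have /andP[uk _] := uC k.
  rewrite thk mulrA ler_pM// ?invr_ge0 ?(ltW (p0 k)) ?(ltW (u0 k))//.
  by rewrite lef_pV2 ?posrE.
have wC2 k : theta%:num ^- k <= C2 * w k.
  have /andP[pk _] := pC k; have /andP[_ uk] := uC k.
  rewrite thk /w mulrCA ler_pM ?invr_ge0 ?(ltW (sk k))//.
  by rewrite ler_pdivlMr// mulrC ler_pdivrMr.
pose g := beta * ((g1 + g2) / 2).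
have g0 : 0 < g by rewrite mulr_gt0// divr_gt0// addr_gt0.
pose K := Kop alpha beta L : L2g theta -> L2g theta.
have Kg (x : L2g theta) : l2w w x (K x) <= - g * l2w w x x.
  exact: (Kop_energy_le alpha_gt0 beta_gt0 rho_lt1 L_ge1 p0 u0 pS wC1 pg ug).
have Klin : linear K by exact: Kop_linear.
have [N N0 KN] := Kop_bounded theta L alpha_gt0 beta_gt0 rho_lt1.
have decay := l2w_decay w0 wC1 Kg.
have C20 : 0 <= C2.
  by have := uC 0%N; rewrite expr0 mulr1 => /andP[/le_trans h /h]; apply: le_trans.
have bound (v : L2g theta) (z : R -> L2g theta) (t : R) :
    is_ode_solution K v z -> 0 <= t ->
    `|z t| ^+ 2 <= C2 * C1 * expR (- (2 * g * t)) * `|v| ^+ 2.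
  move=> zs t0; apply: (le_trans (norm_le_l2w w0 wC1 _ wC2)).
  rewrite -[leRHS]mulrA -[leRHS]mulrA ler_wpM2l//.
  apply: (le_trans (decay _ _ _ zs t0)).
  rewrite [leRHS]mulrCA ler_wpM2l ?expR_ge0//.
  exact: l2w_le_norm w0 wC1 v.
have C10 : 0 <= C1 := weight_bound_ge0 w0 wC1.
exists g, (Num.sqrt (C2 * C1)); split=> // z0.
have zs := exp_op_solution Klin N0 KN z0.
exists (exp_op K ^~ z0); split=> //.
- by move=> t _; exact: (@exp_series_cvg _ _ K N N0 KN t z0).
- move=> y ys t t0.
  have := bound _ _ t (is_ode_solutionB Klin ys zs) t0.
  rewrite subrr normr0 expr0n/= mulr0 => d0; apply/eqP.
  by rewrite -subr_eq0 -normr_eq0 -sqrf_eq0 eq_le d0 sqr_ge0.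
- move=> t t0; rewrite -ler_sqr ?nnegrE ?mulr_ge0 ?expR_ge0 ?sqrtr_ge0//.
  apply: (le_trans (bound _ _ t zs t0)).
  rewrite 2!exprMn [Num.sqrt (C2 * C1) ^+ 2]sqr_sqrtr; last exact: mulr_ge0.
  rewrite [expR _ ^+ 2 * _]mulrC [expR _ ^+ 2]expr2 -expRD.
  by rewrite (_ : - g * t + - g * t = - (2 * g * t)) //; ring.
Qed.
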